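(* Let $f\in\mathcal T_{\pm}$. The average number of local level sets contained in a level set $L_f(y)$ with $y$ chosen at random from the range of $f$ is given by $$\bar N_f^{loc}:=h_f^{-1}\int_{\mathbb R}N_f^{loc}(y)\,dy=h_f^{-1},$$ where $h_f=\operatorname{height}(f)$. In particular, $3/2\le \bar N_f^{loc}\le 2$.
   Context: Let $\phi(x)=\operatorname{dist}(x,\mathbb Z)$ denote the distance from $x\in\mathbb R$ to the nearest integer. $\mathcal T_{\pm}$ is the collection of all functions (signed Takagi functions) of the form $f(x)=\sum_{n=0}^\infty \frac{r_n}{2^n}\phi(2^nx)$ with $r_n\in\{-1,1\}$ for every $n\ge0$. $L_f(y):=\{x\in[0,1]:f(x)=y\}$, and $\operatorname{height}(f):=\max_{x\in[0,1]}f(x)-\min_{x\in[0,1]}f(x)$. For $x\in[0,1)$ write $x=\sum_{n=1}^\infty \varepsilon_n2^{-n}$ with $\varepsilon_n=\varepsilon_n(x)\in\{0,1\}$, taking the representation ending in all zeros if $x$ is a dyadic rational. Let $D_k(x):=\sum_{j=1}^k r_{j-1}(-1)^{\varepsilon_j(x)}$ for $k\ge 0$. Define an equivalence relation on $[0,1)$ by $x\sim x'$ if and only if $|D_j(x)|=|D_j(x')|$ for each $j\in\mathbb N$. The local level set containing $x$ is $L_x^{loc}:=\{x'\in[0,1): x'\sim x\}$. It is a fact that $f(x)=f(x')$ whenever $x\sim x'$, so each local level set is contained in some level set $L_f(y)$. For $y\in\mathbb R$, $N_f^{loc}(y)$ denotes the number (possibly $\infty$; it is $0$ for $y$ outside the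 range of $f$) of local level sets contained in $L_f(y)$. The integral is with respect to Lebesgue measure. *)

(* Defs.v *)
From HB Require Import structures.
From mathcomp Require Import all_boot all_order all_algebra.
From mathcomp Require Import all_classical all_reals all_analysis.
From mathcomp Require Import measurable_realfun.

Set Implicit Arguments.
Unset Strict Implicit.
Unset Printing Implicit Defensive.

Import Order.TTheory GRing.Theory Num.Theory.
Import numFieldNormedType.Exports.

Local Open Scope classical_set_scope.
Local Open Scope ring_scope.

Definition dist_int (R : realType) (x : R) : R :=
  inf [set `|x - z%:~R| | z in [set: int]].

Definition sign_sequence (R : realType) (r : nat -> R) : Prop :=
  forall n, r n = -1 \/ r n = 1.

Definition takagi (R : realType) (r : nat -> R) (x : R) : R :=
  limn (series (fun n => r n / 2 ^+ n * dist_int (2 ^+ n * x))).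

Definition level_set (R : realType) (f : R -> R) (y : R) : set R :=
  [set x | 0 <= x <= 1 /\ f x = y].

(* The maximum (minimum) of [A] is its element that is an upper (lower) bound;
   the default value 0 is only reached when there is none. *)
Definition set_max (R : realType) (A : set R) : R := xget 0 (A `&` ubound A).
Definition set_min (R : realType) (A : set R) : R := xget 0 (A `&` lbound A).

Definition height (R : realType) (f : R -> R) : R :=
  set_max (f @` `[0, 1]) - set_min (f @` `[0, 1]).

Definition dyadic (R : realType) (x : R) : Prop :=
  exists (m : int) (k : nat), x = m%:~R / 2 ^+ k.

(* Digits are indexed from 0: [e n] is the coefficient of 2^-(n+1). *)
Definition binary_expansion (R : realType) (x : R) (e : nat -> bool) : Prop :=
  series (fun n => (e n)%:R / 2 ^+ n.+1 : R) @ \oo --> x /\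
  (dyadic x -> exists n0, forall n, (n0 <= n)%N -> e n = false).

(* Every x in [0, 1) has exactly one such expansion; the default is only
   reached outside of [0, 1). *)
Definition digits (R : realType) (x : R) : nat -> bool :=
  xget (fun=> false) [set e | binary_expansion x e].

(* Because of the shift in [digits], index j below is j - 1 in
   D_k(x) = sum_(1 <= j <= k) r_(j-1) (-1)^(eps_j(x)). *)
Definition Dwalk (R : realType) (r : nat -> R) (k : nat) (x : R) : R :=
  \sum_(0 <= j < k) r j * (-1) ^+ digits x j.

Definition local_equiv (R : realType) (r : nat -> R) (x x' : R) : Prop :=
  forall j, `|Dwalk r j x| = `|Dwalk r j x'|.

Definition local_level_set (R : realType) (r : nat -> R) (x : R) : set R :=
  [set x' | 0 <= x' < 1 /\ local_equiv r x' x].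

Definition local_level_sets (R : realType) (r : nat -> R) : set (set R) :=
  [set local_level_set r x | x in [set x | 0 <= x < 1]].

(* Distinct local level sets are counted once; the value is +oo when there are
   infinitely many. *)
Definition Nloc (R : realType) (r : nat -> R) (y : R) : \bar R :=
  counting (local_level_sets r `&`
            [set A | A `<=` level_set (takagi r) y]).

Definition avg_Nloc (R : realType) (r : nat -> R) : \bar R :=
  (((height (takagi r))^-1)%:E *
   \int[lebesgue_measure]_(y in [set: R]) Nloc r y)%E.

(* Main.v *)
Require Import Defs.
From HB Require Import structures.
From mathcomp Require Import all_boot all_order all_algebra.
From mathcomp Require Import all_classical all_reals all_analysis.
From mathcomp Require Import measurable_realfun.
From mathcomp Require Import finmap ring lra zify.

(** Let [f = takagi r] and let [D_n] be the walk of a binary word [e]. On the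
dyadic interval of order [n] given by the first [n] digits of [e], the [n]-th
partial sum of [f] is affine with slope [D_n], and its value [A_n] at the left
end ([corner]) converges to the value of [f] at the point that [e] represents.

Local level sets. From one order to the next, the value of the partial sum at
the midpoint of the interval changes by a quantity that depends on [r], [|D_n|]
and [|D_n+1|] only ([midpointS]). So [f] is determined by [|D|], and since every
word can be reflected into the word whose walk is [|D|], the local level sets
inside the level set of [y] correspond to the words that have a nonnegative walk
and value [y] ([in_local_level_sets], [local_level_set_inj]). The only obstacle
is that words ending in ones are not the digits of a point of [[0, 1)]; they
affect a countable set of values [y].

Counting. For a finite word [w] of length [n], let [B(w)] be the set of values
of its extensions that have a nonnegative walk ([branch]). The number of [w] of
length [n] such that [y] is in [B(w)] increases to the number of words with
nonnegative walk and value [y]. By monotone convergence, the integral of the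
latter is the limit of the sums of the lengths of the [B(w)].

Lengths. If the walk of [w] is nonnegative and ends at [d], then [B(w)] contains
an interval of length [d / 2^n] ([segment_branch]) and lies in an interval of
length [(d + 1) / 2^n] ([branch_box]). The function [d + 1] is harmonic for the
simple random walk killed at [-1], so the sum of [d + 1] over the nonnegative
walks of length [n] is [2^n] ([kept_mean]). Hence the sum of the lengths of the
[B(w)] lies between [1 - p_n] and [1], where [p_n] is the probability that a
simple random walk stays nonnegative for [n] steps; comparing the second and
third moments of [d + 1] gives [p_n --> 0]. The integral is therefore [1].

Height. The sum of the terms of order [2n] and [2n + 1] of [f] keeps a constant
sign and is at most [4^-n / 2] in absolute value, which bounds the height by
[2 / 3]; the values at [0] and [1 / 2] differ by [1 / 2]. *)

Set Implicit Arguments.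
Unset Strict Implicit.
Unset Printing Implicit Defensive.

Import Order.TTheory GRing.Theory Num.Theory.
Import numFieldNormedType.Exports.

Local Open Scope classical_set_scope.
Local Open Scope ring_scope.

(** * The distance to the nearest integer *)

Section DistInt.
Variable R : realType.
Implicit Types x y : R.

Let dset x : set R := [set `|x - z%:~R| | z in [set: int]].

Let dset_inf x : has_inf (dset x).
Proof.
split; first by exists `|x - 0%:~R|; exists 0.
by exists 0 => _ [z _ <-].
Qed.

Lemma dist_int_le x (z : int) : dist_int x <= `|x - z%:~R|.
Proof. by apply: ge_inf; [have [] := dset_inf x | exists z]. Qed.

Lemma dist_int_ge x c : (forall z : int, c <= `|x - z%:~R|) -> c <= dist_int x.
Proof.
move=> cx; apply: lb_le_inf; first by have [] := dset_inf x.
by move=> _ [z _ <-].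
Qed.

Lemma dist_int_ge0 x : 0 <= dist_int x.
Proof. exact: dist_int_ge. Qed.

Lemma dist_int_lip x y : `|dist_int x - dist_int y| <= `|x - y|.
Proof.
suff H (u v : R) : dist_int u - dist_int v <= `|u - v|.
  by rewrite ler_norml lerNl opprB H distrC H.
rewrite lerBlDl -lerBlDr; apply: dist_int_ge => z; rewrite lerBlDr.
apply: le_trans (dist_int_le u z) _.
have -> : u - z%:~R = (v - z%:~R) + (u - v) by ring.
exact: ler_normD.
Qed.

Lemma dist_int_frac (z : int) (t : R) : 0 <= t <= 1 ->
  dist_int (z%:~R + t) = Num.min t (1 - t).
Proof.
move=> /andP[t0 t1]; apply/eqP; rewrite eq_le; apply/andP; split.
  rewrite le_min; apply/andP; split.
    by have := dist_int_le (z%:~R + t) z; rewrite addrAC subrr add0r ger0_norm.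
  have := dist_int_le (z%:~R + t) (z + 1); rewrite intrD opprD addrACA subrr.
  by rewrite add0r distrC ger0_norm ?subr_ge0.
apply: dist_int_ge => k.
have -> : z%:~R + t - k%:~R = (z - k)%:~R + t :> R by rewrite intrB; ring.
set m := z - k; have [m0|m0] := leP 0 m.
  have m0' : 0 <= m%:~R :> R by rewrite ler0z.
  by rewrite ge_min ger0_norm ?addr_ge0 //; apply/orP; left; rewrite lerDr.
have m1 : m%:~R <= -1 :> R.
  by rewrite -[-1]/((-1)%:~R) ler_int; lia.
rewrite ge_min; apply/orP; right.
have mt : m%:~R + t <= 0 by lra.
by rewrite ler0_norm //; lra.
Qed.

Lemma dist_int_intr (z : int) : dist_int (z%:~R : R) = 0.
Proof.
by rewrite -[z%:~R]addr0 dist_int_frac ?lexx ?ler01 // subr0 min_l ?ler01.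
Qed.

Lemma dist_int_decomp x :
  exists2 t : R, dist_int x = Num.min t (1 - t) &
  exists2 z : int, x = z%:~R + t & 0 <= t < 1.
Proof.
exists (x - (Num.floor x)%:~R); last first.
  exists (Num.floor x); first by ring.
  by rewrite subr_ge0 floor_le_tmp /= ltrBlDl -[_ + 1]/(_ + 1%:~R) -intrD floorD1_gt.
rewrite -[in LHS](subrK (Num.floor x)%:~R x) addrC dist_int_frac //.
rewrite subr_ge0 floor_le_tmp /= lerBlDl -[_ + 1]/(_ + 1%:~R) -intrD.
by rewrite ltW // floorD1_gt.
Qed.

Lemma dist_int_le_half x : dist_int x <= 1 / 2.
Proof.
have [t -> _] := dist_int_decomp x; rewrite ge_min.
by case: (leP t (1 / 2)) => //= ?; lra.
Qed.

(** Together with [dist_int_double_le_compl], this gives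
[0 <= dist_int x +- dist_int (2 * x) / 2 <= 1 / 2]. *)
Lemma dist_int_double_le x : dist_int (2 * x) <= 2 * dist_int x.
Proof.
rewrite [2 * dist_int x]mulrC -ler_pdivrMr //; apply: dist_int_ge => z.
rewrite ler_pdivrMr //; have -> : `|x - z%:~R| * 2 = `|2 * x - (2 * z)%:~R|.
  by rewrite intrM -mulrBr normrM (ger0_norm (ler0n _ 2)) mulrC.
exact: dist_int_le.
Qed.

Lemma dist_int_double_le_compl x : dist_int (2 * x) <= 1 - 2 * dist_int x.
Proof.
have [t -> [z -> /andP[t0 t1]]] := dist_int_decomp x.
have := dist_int_le (2 * (z%:~R + t)) (2 * z + 1).
have -> : 2 * (z%:~R + t) - (2 * z + 1)%:~R = 2 * t - 1 :> R.
  by rewrite intrD intrM; ring.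
move/le_trans; apply; rewrite minEle; case: ifPn => h.
  by rewrite ler0_norm //; lra.
by rewrite ger0_norm; lra.
Qed.

End DistInt.

(** * Binary expansions *)

Section Binary.
Variable R : realType.
Implicit Types (e : nat -> bool) (x : R) (n : nat).

(** The partial sums of the expansion with digits [e]. *)
Definition bsum e : R^nat := series (fun n => (e n)%:R / 2 ^+ n.+1).

(** The point of [[0, 1]] with digits [e]. *)
Definition bval e : R := limn (bsum e).

(** The digits are eventually equal to one. *)
Definition ev_one e := exists n, forall m, (n <= m)%N -> e m.

Lemma half_gt0 n : 0 < (2 ^+ n)^-1 :> R.
Proof. by rewrite invr_gt0 exprn_gt0. Qed.

Lemma half_ge0 n : 0 <= (2 ^+ n)^-1 :> R.
Proof. exact/ltW/half_gt0. Qed.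

Lemma halfS n : (2 ^+ n.+1)^-1 = 2^-1 * (2 ^+ n)^-1 :> R.
Proof. by rewrite exprS invfM. Qed.

Lemma half_cvg0 : (fun n => (2 ^+ n)^-1 : R) @ \oo --> (0 : R).
Proof.
under eq_fun do rewrite -exprVn.
by apply: cvg_expr; rewrite ger0_norm ?invr_ge0 // invf_lt1 // ltr1n.
Qed.

Lemma bsumS e n : bsum e n.+1 = bsum e n + (e n)%:R / 2 ^+ n.+1.
Proof. by rewrite /bsum /series /= big_nat_recr. Qed.

Lemma bsum0 e : bsum e 0 = 0.
Proof. by rewrite /bsum /series /= big_nil. Qed.

Lemma bsum_ge e n m : (n <= m)%N -> bsum e n <= bsum e m.
Proof.
move=> /subnK <-; elim: (m - n)%N => // k IH; rewrite addSn bsumS.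
by rewrite (le_trans IH) // lerDl mulr_ge0 // ltW // half_gt0.
Qed.

Lemma bsum_le e n m : (n <= m)%N ->
  bsum e m <= bsum e n + ((2 ^+ n)^-1 - (2 ^+ m)^-1).
Proof.
move=> /subnK <-; elim: (m - n)%N => [|k IH]; first by rewrite subrr addr0.
rewrite addSn bsumS halfS; have := half_gt0 (k + n).
by case: (e _); rewrite ?mulr1n ?mulr0n; lra.
Qed.

Lemma bsum_is_cvg e : cvgn (bsum e).
Proof.
apply: nondecreasing_is_cvgn; first by move=> n m; exact: bsum_ge.
exists 1 => _ [n _ <-]; have := bsum_le e (leq0n n); rewrite bsum0 expr0 invr1.
by have := half_gt0 n; lra.
Qed.

Lemma bsum_cvg e : bsum e @ \oo --> bval e.
Proof. exact: bsum_is_cvg. Qed.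

Lemma bsum_le_lim e x n : bsum e @ \oo --> x -> bsum e n <= x.
Proof.
move=> ex; rewrite -(cvg_lim _ ex) //.
apply: nondecreasing_cvgn_le; first by move=> k m; exact: bsum_ge.
exact: bsum_is_cvg.
Qed.

Lemma bsum_lim_le e x n : bsum e @ \oo --> x -> x <= bsum e n + (2 ^+ n)^-1.
Proof.
move=> ex; rewrite -(cvg_lim _ ex) //; apply: limr_le; first exact: bsum_is_cvg.
exists n => // m /= nm; apply: le_trans (bsum_le e nm) _.
by have := half_gt0 m; lra.
Qed.

Lemma bsum_lim_lt e x n : ~ ev_one e ->
  bsum e @ \oo --> x -> x < bsum e n + (2 ^+ n)^-1.
Proof.
move=> ne ex; have [m nm em] : exists2 m, (n <= m)%N & e m = false.
  apply: contrapT => H; apply: ne; exists n => m nm.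
  by apply/negPn/negP => /negbTE em; apply: H; exists m.
have := bsum_lim_le m.+1 ex; have := bsum_le e nm; rewrite bsumS em halfS.
by have := half_gt0 m; rewrite mul0r; lra.
Qed.

Lemma bsum_int e n : exists z : int, 2 ^+ n * bsum e n = z%:~R.
Proof.
elim: n => [|n [z IH]]; first by exists 0; rewrite bsum0 mulr0.
exists (2 * z + (e n)%:R); rewrite bsumS mulrDr mulrCA mulfV ?expf_neq0 //.
rewrite exprS -mulrA IH mulr1 intrD intrM; congr (_ + _).
by case: (e n).
Qed.

(** Each digit is determined by the point and the previous digits, provided that
the remainders [x - bsum e n] are less than [2 ^- n]; this is where digits
ending in ones have to be excluded. *)
Lemma bsum_digit e x n : ~ ev_one e -> bsum e @ \oo --> x ->
  e n = (bsum e n + (2 ^+ n.+1)^-1 <= x).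
Proof.
move=> ne ex; have := bsum_lim_lt n.+1 ne ex; have := bsum_le_lim n.+1 ex.
rewrite bsumS; case: (e n); rewrite ?mul1r ?mul0r ?addr0; first by move=> ->.
by move=> _ H; rewrite leNgt H.
Qed.

Lemma bsum_ext e e' n : (forall j, (j < n)%N -> e j = e' j) -> bsum e n = bsum e' n.
Proof.
by move=> ee; rewrite /bsum /series /=; apply: eq_big_nat => j /andP[_ /ee ->].
Qed.

Lemma expansion_unique e e' x : ~ ev_one e -> ~ ev_one e' ->
  bsum e @ \oo --> x -> bsum e' @ \oo --> x -> e = e'.
Proof.
move=> ne ne' ex ex'; suff H n : forall j, (j < n)%N -> e j = e' j.
  by apply/funext => n; exact: (H n.+1).
elim: n => // n IH j; rewrite ltnS leq_eqVlt => /predU1P[->|/IH //].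
by rewrite (bsum_digit _ ne ex) (bsum_digit _ ne' ex') (bsum_ext IH).
Qed.

Lemma ev_one_dyadic e x : ev_one e -> bsum e @ \oo --> x -> dyadic x.
Proof.
move=> [n ne] ex; have [z Hz] := bsum_int e n.
have -> : x = bsum e n + (2 ^+ n)^-1.
  rewrite -(cvg_lim _ ex) //; apply: cvg_lim => //.
  rewrite -(cvg_shiftn n) -[_ + _^-1]subr0.
  have -> : (fun k => bsum e (k + n)) =
            (fun k => bsum e n + (2 ^+ n)^-1 - (2 ^+ (k + n))^-1).
    apply/funext; elim=> [|k IH]; first by rewrite addrK.
    by rewrite addSn bsumS IH ne ?leq_addl // halfS mulr1n; lra.
  apply: cvgB; first exact: cvg_cst.
  by rewrite (cvg_shiftn n (fun k => (2 ^+ k)^-1 : R)); exact: half_cvg0.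
exists (z + 1), n; rewrite intrD -Hz mulrDl mul1r; congr (_ + _).
by rewrite mulrAC mulfV ?mul1r ?expf_neq0.
Qed.

Lemma expansion_not_ev_one e x : binary_expansion x e -> ~ ev_one e.
Proof.
move=> [ex dx] e1; have [n0 H0] := dx (ev_one_dyadic e1 ex).
case: e1 => n1 H1; have := H1 (maxn n0 n1) (leq_maxr _ _).
by rewrite H0 ?leq_maxl.
Qed.

(** The largest dyadic rational of order [n] not exceeding [x], for [x] in
[[0, 1)], obtained by choosing each digit greedily. *)
Fixpoint greedy x n : R := if n is k.+1 then
  greedy x k + (greedy x k + (2 ^+ k.+1)^-1 <= x)%R%:R / 2 ^+ k.+1 else 0.

Lemma expansion_exists x : 0 <= x < 1 -> exists e, binary_expansion x e.
Proof.
move=> /andP[x0 x1].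
pose e k := (greedy x k + (2 ^+ k.+1)^-1 <= x).
have Eg n : bsum e n = greedy x n.
  by elim: n => [|n IH]; rewrite ?bsum0 // bsumS IH.
have B n : bsum e n <= x < bsum e n + (2 ^+ n)^-1.
  elim: n => [|n /andP[IH1 IH2]]; first by rewrite bsum0 expr0 invr1 add0r x0.
  rewrite bsumS /e -Eg halfS.
  case: (leP (bsum e n + 2^-1 * _) x) => /= H; rewrite ?mulr1n ?mulr0n;
    by apply/andP; split; lra.
exists e; split.
  have : (fun n => x - (2 ^+ n)^-1) @ \oo --> x - 0.
    by apply: cvgB; [exact: cvg_cst | exact: half_cvg0].
  rewrite subr0 => xx; apply: (squeeze_cvgr _ xx (cvg_cst x)).
  by apply: nearW => n /=; have /andP[B1 B2] := B n; rewrite B1 andbT lerBlDr ltW.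
(* If [x] is dyadic of order [k], then [2 ^ k * x] and [2 ^ k * bsum e k] are
   integers that differ by less than one, so all digits from [k] on vanish. *)
move=> [m [k xE]]; exists k => n kn.
have xk : bsum e k = x.
  have [z Hz] := bsum_int e k; have /andP[B1 B2] := B k.
  have k0 : 0 < 2 ^+ k :> R by rewrite exprn_gt0.
  have xm : 2 ^+ k * x = m%:~R by rewrite xE mulrCA mulfV ?mulr1 ?lt0r_neq0.
  apply: (mulfI (lt0r_neq0 k0)); rewrite Hz xm.
  rewrite -(ler_pM2l k0) Hz xm in B1; rewrite -(ltr_pM2l k0) mulrDr Hz xm in B2.
  move: B1 B2; rewrite mulfV ?lt0r_neq0 // ler_int -[1]/(1%:~R) -intrD ltr_int.
  move=> zm mz.
  by congr _%:~R; lia.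
rewrite /e -Eg; apply/negbTE; rewrite -ltNge.
by rewrite ltr_pwDr ?half_gt0 // -[leLHS]xk bsum_ge.
Qed.

Lemma digitsP x : 0 <= x < 1 -> binary_expansion x (digits x).
Proof. by move=> /expansion_exists; exact: xgetPex. Qed.

Lemma bval_ge0 e : 0 <= bval e.
Proof. by rewrite -(bsum0 e); apply: bsum_le_lim; exact: bsum_cvg. Qed.

Lemma bval_lt1 e : ~ ev_one e -> bval e < 1.
Proof.
by move=> /(bsum_lim_lt 0)/(_ (@bsum_cvg e)); rewrite bsum0 expr0 invr1 add0r.
Qed.

Lemma digits_bval e : ~ ev_one e -> digits (bval e) = e.
Proof.
move=> ne; have dx : binary_expansion (bval e) (digits (bval e)).
  by apply: digitsP; rewrite bval_ge0 bval_lt1.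
apply: (expansion_unique _ ne _ (@bsum_cvg e)); last by case: dx.
exact: expansion_not_ev_one dx.
Qed.

End Binary.
Arguments bsum {R}.
Arguments bval {R}.

(** * The walk and the convergence of the partial sums *)

Section Walk.
Variables (R : realType) (r : nat -> R).
Hypothesis hr : sign_sequence r.
Implicit Types (e : nat -> bool) (x : R) (n : nat).

(** The walk [D] of the context, as a function of the digits; [Dwalk r n x] is
[walk (digits x) n]. *)
Definition walk e n : R := \sum_(0 <= j < n) r j * (-1) ^+ e j.

(** The value of the signed Takagi function at the dyadic rational [bsum e n],
written in terms of the digits: it grows by
[(D_j + r_j) / 2 ^ (j + 1)] when the digit [e j] is one. *)
Definition corner e n : R :=
  \sum_(0 <= j < n) (e j)%:R * (walk e j + r j) / 2 ^+ j.+1.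

Lemma walkS e n : walk e n.+1 = walk e n + r n * (-1) ^+ e n.
Proof. by rewrite /walk big_nat_recr. Qed.

Lemma walk0 e : walk e 0 = 0.
Proof. by rewrite /walk big_nil. Qed.

Lemma cornerS e n :
  corner e n.+1 = corner e n + (e n)%:R * (walk e n + r n) / 2 ^+ n.+1.
Proof. by rewrite /corner big_nat_recr. Qed.

Lemma corner0 e : corner e 0 = 0.
Proof. by rewrite /corner big_nil. Qed.

Lemma walk_ext e e' n : (forall j, (j < n)%N -> e j = e' j) ->
  walk e n = walk e' n.
Proof. by move=> ee; apply: eq_big_nat => j /andP[_ /ee ->]. Qed.

Lemma corner_ext e e' n : (forall j, (j < n)%N -> e j = e' j) ->
  corner e n = corner e' n.
Proof.
move=> ee; apply: eq_big_nat => j /andP[_ jn]; rewrite ee // (@walk_ext e e') //.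
by move=> k kj; apply: ee; exact: ltn_trans jn.
Qed.

Lemma sign_norm n : `|r n| = 1.
Proof. by case: (hr n) => ->; rewrite ?normrN normr1. Qed.

Lemma sign_step n (b : bool) : r n * (-1) ^+ b = 1 \/ r n * (-1) ^+ b = -1.
Proof.
by case: (hr n) => ->; case: b; rewrite /= ?expr1 ?expr0;
  [left|right|right|left]; ring.
Qed.

Lemma walk_int e n : exists z : int, walk e n = z%:~R.
Proof.
elim: n => [|n [z IH]]; first by exists 0; rewrite walk0.
rewrite walkS IH; case: (sign_step n (e n)) => ->.
  by exists (z + 1); rewrite intrD.
by exists (z - 1); rewrite intrB.
Qed.

Lemma walk_norm_le e n : `|walk e n| <= n%:R.
Proof.
elim: n => [|n IH]; first by rewrite walk0 normr0.
rewrite walkS; apply: le_trans (ler_normD _ _) _; rewrite -natr1 lerD //.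
by case: (sign_step n (e n)) => ->; rewrite ?normrN normr1.
Qed.

Lemma nat_half_cvg0 : (fun n => n%:R / 2 ^+ n : R) @ \oo --> (0 : R).
Proof.
(* [n / 2 ^ n] is compared with [2 * (3 / 4) ^ n]. *)
have B n : n.+2%:R <= 2 * (3 / 2) ^+ n :> R.
  elim: n => [|n IH]; first by rewrite expr0 mulr1.
  rewrite exprS -natr1; move: IH; have : 2 <= n.+2%:R :> R by rewrite ler_nat.
  by move: (n.+2%:R) (_ ^+ n) => a p; lra.
have : geometric (2 : R) (3 / 4) @ \oo --> (0 : R).
  by apply: cvg_geometric; rewrite ger0_norm; lra.
apply: (squeeze_cvgr _ (cvg_cst 0)); apply: nearW => n; apply/andP; split.
  by rewrite mulr_ge0 // ltW // half_gt0.
rewrite /geometric /= ler_pdivrMr ?exprn_gt0 // -mulrA -exprMn.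
have -> : 3 / 4 * 2 = 3 / 2 :> R by lra.
by apply: le_trans (B n); rewrite ler_nat; lia.
Qed.

Lemma walk_half_cvg0 e : (fun n => walk e n / 2 ^+ n) @ \oo --> (0 : R).
Proof.
apply/norm_cvg0P; apply: (squeeze_cvgr _ (cvg_cst 0) nat_half_cvg0).
apply: nearW => n /=; rewrite normr_ge0 normrM (@ger0_norm _ _^-1) ?half_ge0 //.
by rewrite ler_pM2r ?half_gt0 // walk_norm_le.
Qed.

(** [2 ^ n * x] is the integer [2 ^ n * bsum e n] plus a remainder in [[0, 1]]. If
the digit [e n] is zero, the remainder is at most one half and is the distance
to the nearest integer; otherwise this distance is one minus the remainder. *)
Lemma dist_int_bsum e x n : bsum e @ \oo --> x ->
  dist_int (2 ^+ n * x) / 2 ^+ n =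
  (e n)%:R / 2 ^+ n.+1 + (-1) ^+ e n * (x - bsum e n.+1).
Proof.
move=> ex; have [z Hz] := bsum_int R e n.
have n0 : 0 < 2 ^+ n :> R by rewrite exprn_gt0.
have l1 := bsum_le_lim n.+1 ex; have l2 := bsum_lim_le n.+1 ex.
have xE : 2 ^+ n * x = z%:~R + 2 ^+ n * (x - bsum e n) by rewrite -Hz; ring.
have nh : 2 ^+ n * (2 ^+ n)^-1 = 1 :> R by rewrite mulfV ?lt0r_neq0.
move: l1 l2 xE; rewrite bsumS halfS => l1 l2 ->.
set h := (2 ^+ n)^-1 in nh l1 l2 *; set H := 2 ^+ n in n0 nh *.
set t := x - bsum e n.
have h0 : 0 < h := half_gt0 R n.
have t0 : 0 <= H * t <= 1.
  apply/andP; split.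
    by rewrite mulr_ge0 ?(ltW n0) // /t; move: l1 l2; case: (e n) => /=; lra.
  by rewrite -nh ler_pM2l // /t; move: l1 l2; case: (e n) => /=; lra.
have E : H * t * h = t by rewrite mulrAC nh mul1r.
have Eh : H * (2^-1 * h) = 2^-1 by rewrite mulrCA nh mulr1.
rewrite dist_int_frac //; case: (e n) l1 l2 => l1 l2.
  have -> : Num.min (H * t) (1 - H * t) = 1 - H * t.
    rewrite min_r //; suff : H * (2^-1 * h) <= H * t by rewrite Eh; lra.
    by rewrite ler_pM2l // /t; move: l1 l2 => /=; lra.
  by rewrite mulrBl E /t /= expr1; lra.
have -> : Num.min (H * t) (1 - H * t) = H * t.
  rewrite min_l //; suff : H * t <= H * (2^-1 * h) by rewrite Eh; lra.
  by rewrite ler_pM2l // /t; move: l1 l2 => /=; lra.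
by rewrite E /t /= expr0; lra.
Qed.

(** The partial sums of the signed Takagi function. *)
Definition takagi_sum x : R^nat :=
  series (fun n => r n / 2 ^+ n * dist_int (2 ^+ n * x)).

Lemma takagi_sumS x n :
  takagi_sum x n.+1 = takagi_sum x n + r n / 2 ^+ n * dist_int (2 ^+ n * x).
Proof. by rewrite /takagi_sum /series /= big_nat_recr. Qed.

(** The partial sum of order [n] is affine with slope [walk e n] on the dyadic
interval of order [n] starting at [bsum e n]. *)
Lemma takagi_sumE e x n : bsum e @ \oo --> x ->
  takagi_sum x n = corner e n + walk e n * (x - bsum e n).
Proof.
move=> ex; elim: n => [|n IH].
  by rewrite /takagi_sum /series /= big_nil corner0 walk0 mul0r addr0.
rewrite takagi_sumS IH -mulrA [_^-1 * _]mulrC (dist_int_bsum n ex).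
rewrite cornerS walkS bsumS; move: ((2 ^+ n.+1)^-1) => c.
by case: (e n); rewrite /= ?expr1 ?expr0; ring.
Qed.

Lemma takagi_sum_tail x n m : (n <= m)%N ->
  `|takagi_sum x m - takagi_sum x n| <= (2 ^+ n)^-1 - (2 ^+ m)^-1.
Proof.
move=> /subnK <-; elim: (m - n)%N => [|k IH]; first by rewrite !subrr normr0.
rewrite addSn takagi_sumS halfS addrAC; apply: le_trans (ler_normD _ _) _.
have : `|r (k + n)%N / 2 ^+ (k + n) * dist_int (2 ^+ (k + n) * x)| <=
    (2 ^+ (k + n))^-1 / 2.
  rewrite !normrM sign_norm mul1r ger0_norm ?half_ge0 // ler_pM2l ?half_gt0 //.
  by rewrite ger0_norm ?dist_int_ge0 // -[2^-1]mul1r dist_int_le_half.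
lra.
Qed.

Lemma takagi_sum_is_cvg x : cvgn (takagi_sum x).
Proof.
apply: normed_cvg.
have h1 : `|2^-1 : R| < 1 by rewrite ger0_norm; lra.
apply: (series_le_cvg _ _ _ (is_cvg_geometric_series (a := 1) h1)) => n //=.
rewrite !normrM sign_norm mul1r ger0_norm ?half_ge0 // mul1r exprVn.
rewrite ler_piMr ?half_ge0 // ger0_norm ?dist_int_ge0 //.
by have := dist_int_le_half (2 ^+ n * x); lra.
Qed.

Lemma takagi_sum_cvg x : takagi_sum x @ \oo --> takagi r x.
Proof. exact: takagi_sum_is_cvg. Qed.

Lemma takagi_sum_near x n : `|takagi r x - takagi_sum x n| <= (2 ^+ n)^-1.
Proof.
have H : (fun m => `|takagi_sum x m - takagi_sum x n|) @ \oo -->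
    `|takagi r x - takagi_sum x n|.
  by apply: cvg_norm; apply: cvgB; [exact: takagi_sum_cvg|exact: cvg_cst].
rewrite -(cvg_lim _ H) //; apply: limr_le; first by apply/cvg_ex; eexists; exact: H.
exists n => // m /= nm; apply: le_trans (takagi_sum_tail x nm) _.
by have := half_gt0 R m; lra.
Qed.

Lemma corner_cvg e x : bsum e @ \oo --> x -> corner e @ \oo --> takagi r x.
Proof.
move=> ex; have -> : corner e = fun n => takagi_sum x n - walk e n * (x - bsum e n).
  by apply/funext => n; rewrite (takagi_sumE n ex) addrK.
rewrite -[takagi r x]subr0; apply: cvgB; first exact: takagi_sum_cvg.
apply/norm_cvg0P; apply: (squeeze_cvgr _ (cvg_cst 0) nat_half_cvg0).
apply: nearW => n /=; rewrite normr_ge0 normrM.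
have := bsum_le_lim n ex; have := bsum_lim_le n ex => l1 l2.
rewrite ler_pM ?walk_norm_le // ger0_norm; lra.
Qed.

End Walk.

(** * Local level sets and nonnegative walks *)

Section Reflection.
Variables (R : realType) (r : nat -> R).
Hypothesis hr : sign_sequence r.
Implicit Types (e : nat -> bool) (x : R) (n : nat).

(** [corner r e n + walk r e n / 2 ^+ n.+1] is the value of the partial sum of
order [n] at the midpoint of the dyadic interval of order [n]. Its increments,
hence its limit, depend on the absolute value of the walk only. *)
Lemma midpointS e n :
  corner r e n.+1 + walk r e n.+1 / 2 ^+ n.+2 =
  corner r e n + walk r e n / 2 ^+ n.+1 +
  r n * (3 + `|walk r e n| ^+ 2 - `|walk r e n.+1| ^+ 2) / 2 ^+ n.+3.
Proof.
rewrite cornerS walkS !real_normK ?num_real // !halfS.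
by case: (hr n) => ->; case: (e n); rewrite /= ?expr1 ?expr0; field;
  rewrite expf_neq0.
Qed.

Lemma eq_midpoint e e' n : (forall j, `|walk r e j| = `|walk r e' j|) ->
  corner r e n + walk r e n / 2 ^+ n.+1 = corner r e' n + walk r e' n / 2 ^+ n.+1.
Proof.
move=> ee; elim: n => [|n IH]; first by rewrite !corner0 !walk0.
by rewrite !midpointS IH !ee.
Qed.

Lemma midpoint_cvg e x : bsum e @ \oo --> x ->
  (fun n => corner r e n + walk r e n / 2 ^+ n.+1) @ \oo --> takagi r x.
Proof.
move=> ex; have -> : (fun n => corner r e n + walk r e n / 2 ^+ n.+1) =
    (corner r e \+ (fun n => walk r e n / 2 ^+ n) \* (fun=> 2^-1)).
  by apply/funext => n /=; rewrite halfS; ring.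
have := cvgD (corner_cvg hr ex) (cvgM (walk_half_cvg0 hr e) (cvg_cst (2^-1 : R))).
by rewrite mul0r addr0; apply.
Qed.

(** Equivalent points have the same value. *)
Lemma takagi_eq_abs_walk e e' x x' : bsum e @ \oo --> x -> bsum e' @ \oo --> x' ->
  (forall j, `|walk r e j| = `|walk r e' j|) -> takagi r x = takagi r x'.
Proof.
move=> /midpoint_cvg cx /midpoint_cvg cx' ee.
rewrite -(cvg_lim _ cx) // -(cvg_lim _ cx') //; congr (lim (_ @ \oo)).
by apply/funext => n; exact: eq_midpoint.
Qed.

Lemma walk_inj e e' : (forall j, walk r e j = walk r e' j) -> e = e'.
Proof.
move=> ee; apply/funext => n; have := ee n.+1; rewrite !walkS ee => /addrI.
by case: (hr n) => ->; case: (e n); case: (e' n) => //=; rewrite ?expr1 ?expr0; lra.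
Qed.

Lemma walk_case e n : [\/ walk r e n = 0, 1 <= walk r e n | walk r e n <= -1].
Proof.
have [z ->] := walk_int hr e n; have [z0|z0|->] := ltrgt0P z.
- by apply: Or32; rewrite -[1]/(1%:~R) ler_int.
- by apply: Or33; rewrite -[-1]/((-1)%:~R) ler_int; lia.
- exact: Or31.
Qed.

Lemma reflection e : exists e', forall n, walk r e' n = `|walk r e n|.
Proof.
(* The digit is one exactly when the step of [|D|] is [- r n]. *)
exists (fun n => `|walk r e n.+1| - `|walk r e n| != r n); elim=> [|n IH].
  by rewrite !walk0 normr0.
rewrite walkS {}IH.
have : `|walk r e n.+1| - `|walk r e n| = 1 \/
       `|walk r e n.+1| - `|walk r e n| = -1.
  (* A walk on the integers with steps of size one cannot jump over zero. *)
  rewrite walkS; case: (walk_case e n) => [->|D1|D1].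
  - left; rewrite normr0 add0r subr0.
    by case: (sign_step hr n (e n)) => ->; rewrite ?normrN normr1.
  - rewrite !ger0_norm; [|lra|case: (sign_step hr n (e n)) => ->; lra].
    by case: (sign_step hr n (e n)) => ->; [left|right]; ring.
  - rewrite !ler0_norm; [|lra|case: (sign_step hr n (e n)) => ->; lra].
    by case: (sign_step hr n (e n)) => ->; [right|left]; ring.
case: eqP => [E _|NE H] /=; first by rewrite expr0 -E; ring.
by rewrite expr1; case: (hr n) (NE) => ->; case: H => H; rewrite H => ?; lra.
Qed.

(** The digits that have a nonnegative walk and represent a point of value [y]. *)
Definition nonneg_fiber (y : R) : set (nat -> bool) :=
  [set e | (forall n, 0 <= walk r e n) /\ takagi r (bval e) = y].

Lemma ev_one_countable : countable ev_one.
Proof.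
have this : ev_one = range (fun s : seq bool => nth true s).
  apply/seteqP; split=> [e [n en]|_ [s _ <-]]; last first.
    by exists (size s) => m sm; rewrite nth_default.
  exists (mkseq e n) => //; apply/funext => m; have [mn|nm] := ltnP m n.
    by rewrite nth_mkseq.
  by rewrite nth_default ?size_mkseq // en.
rewrite this; exact: card_le_trans (card_image_le _ _) (countableP _).
Qed.

(** The values at the points represented by digits ending in ones. *)
Definition exceptional : set R := [set takagi r (bval e) | e in ev_one].

Lemma exceptional_countable : countable exceptional.
Proof. exact: card_le_trans (card_image_le _ _) ev_one_countable. Qed.

(** Each nonnegative walk [D] in the fiber of [y] gives the local level set of
the points whose walk is [D] up to sign. *)
Lemma in_local_level_sets y : ~ exceptional y ->
  local_level_sets r `&` [set A | A `<=` level_set (takagi r) y] =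
  (fun e => [set x | 0 <= x < 1 /\ forall j, `|Dwalk r j x| = walk r e j]) @`
  nonneg_fiber y.
Proof.
move=> ny; apply/seteqP; split=> [A [[x /= x01 <-]] xy|A [e [e0 ey] <-]].
  have [dx _] := digitsP x01.
  have [e He] := reflection (digits x).
  exists e.
    split=> [n|]; first by rewrite He.
    have [] : level_set (takagi r) y x by apply: xy; split.
    move=> _ <-; apply: takagi_eq_abs_walk dx _; first exact: bsum_cvg.
    by move=> j; rewrite He normr_id.
  apply/seteqP; split=> x' [x'01 H]; split=> // j.
    by rewrite H He.
  by rewrite H He.
have ne : ~ ev_one e by move=> e1; apply: ny; exists e.
have x01 : 0 <= (bval e : R) < 1 by rewrite bval_ge0 bval_lt1.
have De j : `|Dwalk r j (bval e)| = walk r e j.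
  by rewrite -[Dwalk _ _ _]/(walk r (digits (bval e)) j) digits_bval // ger0_norm.
split; last first.
  move=> x /= [xx H]; split; first by case/andP: xx => -> /ltW ->.
  have [dx _] := digitsP xx.
  rewrite -ey; apply: takagi_eq_abs_walk dx (@bsum_cvg _ e) _ => j.
  by rewrite [LHS]H ger0_norm.
exists (bval e) => //; apply/seteqP; split=> x [xx H]; split=> // j.
  by rewrite H De.
by rewrite H De.
Qed.

Lemma local_level_set_inj y : ~ exceptional y ->
  {in nonneg_fiber y &, injective
   (fun e => [set x : R | 0 <= x < 1 /\ forall j, `|Dwalk r j x| = walk r e j])}.
Proof.
move=> ny e e' /set_mem[e0 ey] /set_mem[e'0 ey'] E; apply: walk_inj => j.
have ne : ~ ev_one e by move=> e1; apply: ny; exists e.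
have x01 : 0 <= (bval e : R) < 1 by rewrite bval_ge0 bval_lt1.
have De i : `|Dwalk r i (bval e)| = walk r e i.
  by rewrite -[Dwalk _ _ _]/(walk r (digits (bval e)) i) digits_bval // ger0_norm.
have : [set x : R | 0 <= x < 1 /\ forall j, `|Dwalk r j x| = walk r e j]
  (bval e) by [].
by rewrite E => -[_ H]; rewrite -De H.
Qed.

End Reflection.

(** * The height *)

Section Height.
Variables (R : realType) (r : nat -> R).
Hypothesis hr : sign_sequence r.
Implicit Types (x y : R) (n : nat).

Lemma le_half_all (a b c : R) : (forall n, a <= b + c * (2 ^+ n)^-1) -> a <= b.
Proof.
move=> H.
have Hc : (fun n => b + c * (2 ^+ n)^-1) @ \oo --> b + c * 0.
  by apply: cvgD; [exact: cvg_cst | apply: cvgM; [exact: cvg_cst|exact: half_cvg0]].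
by rewrite mulr0 addr0 in Hc; apply: (cvgr_to_ge Hc); exact: nearW.
Qed.

Lemma takagi_sum_lip x y n :
  `|takagi_sum r x n - takagi_sum r y n| <= n%:R * `|x - y|.
Proof.
elim: n => [|n IH].
  by rewrite /takagi_sum /series /= !big_nil subrr normr0 mul0r.
rewrite !takagi_sumS opprD addrACA -[n.+1%:R]natr1 mulrDl mul1r.
apply: le_trans (ler_normD _ _) _; apply: lerD IH _.
rewrite -mulrBr !normrM sign_norm // mul1r (ger0_norm (half_ge0 _ _)).
rewrite mulrC ler_pdivrMr ?exprn_gt0 //; apply: le_trans (dist_int_lip _ _) _.
by rewrite -mulrBr normrM (@ger0_norm _ (2 ^+ n)) ?exprn_ge0 // mulrC.
Qed.

Lemma takagi_continuous : continuous (takagi r).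
Proof.
move=> x; apply/cvgrPdist_le => e e0.
have [n ne] : exists n, (2 ^+ n)^-1 <= e / 4.
  have /cvgr0Pnorm_le/(_ (e / 4)) H := @half_cvg0 R.
  have [|n _ /(_ n (leqnn n)) /= Hn] := H; first by rewrite divr_gt0.
  by exists n; rewrite -(ger0_norm (half_ge0 R n)).
near=> y.
have xy : `|x - y| <= e / 2 / n.+1%:R.
  by near: y; apply: cvgr_dist_le => //; rewrite !divr_gt0.
have := takagi_sum_lip x y n; have := takagi_sum_near hr x n.
have := takagi_sum_near hr y n; rewrite !ler_distl.
move=> /andP[a1 a2] /andP[a3 a4] /andP[a5 a6].
have : n%:R * `|x - y| <= e / 2.
  move: xy; rewrite ler_pdivlMr // => xy; apply: le_trans xy.
  by rewrite mulrC ler_wpM2l // ler_nat.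
by move=> ?; apply/andP; split; lra.
Unshelve. all: by end_near.
Qed.

(** The terms are grouped in pairs, each of which oscillates by at most
[4^-n / 2]. *)
Lemma takagi_osc x y : takagi r x - takagi r y <= 2 / 3.
Proof.
have pair z : forall s t : R, s = -1 \/ s = 1 -> t = -1 \/ t = 1 ->
    [/\ s = 1 -> 0 <= s * dist_int z + t / 2 * dist_int (2 * z) <= 1 / 2 &
    s = -1 -> -1/2 <= s * dist_int z + t / 2 * dist_int (2 * z) <= 0].
  move=> s t hs ht; have H1 := dist_int_double_le z.
  have H2 := dist_int_double_le_compl z.
  have H3 := dist_int_ge0 z; have H4 := dist_int_ge0 (2 * z).
  by split=> ->; case: ht => ->; apply/andP; split; lra.
have B n : takagi_sum r x n.*2 - takagi_sum r y n.*2 <=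
    2 / 3 * (1 - (2 ^+ n.*2)^-1).
  elim: n => [|n IH].
    by rewrite /takagi_sum /series /= !big_nil expr0 invr1 !subrr mulr0.
  rewrite doubleS !takagi_sumS !exprS !invfM.
  rewrite -[2 * 2 ^+ _ * x]mulrA -[2 * 2 ^+ _ * y]mulrA.
  have [p1 p2] := pair (2 ^+ n.*2 * x) _ _ (hr n.*2) (hr n.*2.+1).
  have [q1 q2] := pair (2 ^+ n.*2 * y) _ _ (hr n.*2) (hr n.*2.+1).
  have h0 := half_gt0 R n.*2; set h := (2 ^+ n.*2)^-1 in IH h0 *.
  set a := dist_int (2 ^+ _ * x); set b := dist_int (2 * _).
  set a' := dist_int (2 ^+ _ * y); set b' := dist_int (2 * (_ * y)).
  have : h * ((r n.*2 * a + r n.*2.+1 / 2 * b) -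
              (r n.*2 * a' + r n.*2.+1 / 2 * b')) <= h * (1 / 2).
    rewrite ler_pM2l //; case: (hr n.*2) => E.
      by have /andP[] := p2 E; have /andP[] := q2 E; lra.
    by have /andP[] := p1 E; have /andP[] := q1 E; lra.
  lra.
apply: (@le_half_all _ _ 2) => n.
have := B n; have := takagi_sum_near hr x n.*2; have := takagi_sum_near hr y n.*2.
have : (2 ^+ n.*2)^-1 <= (2 ^+ n)^-1 :> R.
  rewrite ler_pV2 ?inE ?unitfE ?exprn_gt0 ?expf_neq0 //.
  by rewrite ler_eXn2l ?ltr1n // -addnn leq_addr.
have := half_gt0 R n.*2.
by rewrite !ler_distl => h0 hh /andP[a1 a2] /andP[a3 a4] a5; lra.
Qed.

Lemma takagi_at0 : takagi r 0 = 0.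
Proof.
apply/eqP; rewrite -normr_le0; apply: (@le_half_all _ _ 1) => n.
have S0 : takagi_sum r 0 n = 0.
  elim: n => [|n IH]; first by rewrite /takagi_sum /series /= big_nil.
  by rewrite takagi_sumS IH mulr0 (dist_int_intr _ 0) mulr0 addr0.
by have := takagi_sum_near hr 0 n; rewrite S0 subr0 add0r mul1r.
Qed.

Lemma takagi_at_half : takagi r (1 / 2) = r 0%N / 2.
Proof.
have d2 : dist_int (1 / 2 : R) = 1 / 2.
  rewrite -[in LHS](add0r (1 / 2)) (dist_int_frac 0) ?min_l //; first lra.
  by apply/andP; split; lra.
apply/eqP; rewrite -subr_eq0 -normr_le0; apply: (@le_half_all _ _ 1) => n.
have Sn : takagi_sum r (1 / 2) n.+1 = r 0%N / 2.
  elim: n => [|n IH].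
    rewrite takagi_sumS /takagi_sum /series /= big_nil expr0 divr1 mul1r.
    by rewrite add0r d2 mul1r.
  rewrite takagi_sumS IH; have -> : 2 ^+ n.+1 * (1 / 2) = (2 ^ n)%N%:~R :> R.
    by rewrite -[_%:~R]/((2 ^ n)%:R) natrX exprS; lra.
  by rewrite dist_int_intr mulr0 addr0.
have := takagi_sum_near hr (1 / 2) n.+1; rewrite Sn halfS.
by have := half_gt0 R n; lra.
Qed.

Lemma height_itv : 1 / 2 <= height (takagi r) <= 2 / 3.
Proof.
have cf : {within `[0, 1], continuous (takagi r)}.
  by apply: continuous_subspaceT; exact: takagi_continuous.
have [c c01 fc] := EVT_max ler01 cf; have [d d01 fd] := EVT_min ler01 cf.
have -> : height (takagi r) = takagi r c - takagi r d.
  congr (_ - _).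
    rewrite /set_max; case: xgetP => [_ -> [[x /= x01 <-] ub]|H].
      apply/eqP; rewrite eq_le fc //=; apply: ub; exists c => //.
    by case: (H (takagi r c)); split; [exists c|move=> _ [x /= x01 <-]; exact: fc].
  rewrite /set_min; case: xgetP => [_ -> [[x /= x01 <-] lb]|H].
    apply/eqP; rewrite eq_le fd // andbT; apply: lb; exists d => //.
  by case: (H (takagi r d)); split; [exists d|move=> _ [x /= x01 <-]; exact: fd].
rewrite takagi_osc andbT.
have := fc 0; have := fd 0; have := fc (1 / 2); have := fd (1 / 2).
have i0 : (0 : R) \in `[0, 1] by rewrite in_itv /= lexx ler01.
have i1 : (1 / 2 : R) \in `[0, 1] by rewrite in_itv /=; apply/andP; split; lra.
move=> /(_ i1) A /(_ i1) B /(_ i0) C /(_ i0) D.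
by move: A B C D; rewrite takagi_at0 takagi_at_half; case: (hr 0%N) => ->; lra.
Qed.

End Height.

(** * Finite words with a nonnegative walk *)

(** The words of length [n]. *)
Fixpoint words n : seq (seq bool) := if n is m.+1 then
  [seq rcons w false | w <- words m] ++ [seq rcons w true | w <- words m]
  else [:: [::]].

Lemma mem_words n w : (w \in words n) = (size w == n).
Proof.
elim: n w => [|n IH] w; first by rewrite mem_seq1 size_eq0.
case/lastP: w => [|w b].
  apply/negbTE; rewrite mem_cat negb_or.
  by apply/andP; split; apply/mapP => -[v _]; case: v.
rewrite size_rcons eqSS mem_cat.
have inj c : injective (fun v : seq bool => rcons v c) by move=> u v /rcons_inj[].
have ne c d : c != d -> rcons w c \in [seq rcons v d | v <- words n] = false.
  move=> cd; apply/negbTE/mapP => -[v _ /rcons_inj[_ E]].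
  by rewrite E eqxx in cd.
have mm c : (rcons w c \in [seq rcons v c | v <- words n]) = (w \in words n).
  exact: (mem_map (inj c)).
by case: b; rewrite mm ne ?orbF ?IH.
Qed.

Lemma uniq_words n : uniq (words n).
Proof.
elim: n => //= n IH.
have inj c : injective (fun v : seq bool => rcons v c) by move=> u v /rcons_inj[].
rewrite cat_uniq !map_inj_uniq // IH andbT /=; apply/hasPn => _ /mapP[v _ ->].
by apply/mapP => -[u _ /rcons_inj[]].
Qed.

Lemma big_words (V : nmodType) n (F : seq bool -> V) :
  \sum_(w <- words n.+1) F w =
  \sum_(w <- words n) (F (rcons w false) + F (rcons w true)).
Proof. by rewrite /= big_cat !big_map big_split. Qed.

Section Kept.
Variables (R : realType) (r : nat -> R).
Hypothesis hr : sign_sequence r.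
Implicit Types (e : nat -> bool) (x : R) (n : nat) (w : seq bool) (b : bool).

(** The final position of the walk of a finite word, and the corresponding
corner. Beyond [size w] the default digit plays no role. *)
Definition wwalk w : R := walk r (nth false w) (size w).
Definition wcorner w : R := corner r (nth false w) (size w).
(** The walk of [w] is nonnegative at all times from [0] to [size w]. *)
Definition kept w : bool :=
  all (fun j => 0 <= walk r (nth false w) j) (iota 0 (size w).+1).

Lemma nth_rcons_lt w b j : (j < size w)%N -> nth false (rcons w b) j = nth false w j.
Proof. by rewrite nth_rcons => ->. Qed.

Lemma nth_rcons_size w b : nth false (rcons w b) (size w) = b.
Proof. by rewrite nth_rcons ltnn eqxx. Qed.

Lemma wwalk_rcons w b : wwalk (rcons w b) = wwalk w + r (size w) * (-1) ^+ b.
Proof.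
rewrite /wwalk size_rcons walkS nth_rcons_size; congr (_ + _).
by apply: walk_ext => j; exact: nth_rcons_lt.
Qed.

Lemma wcorner_rcons w b : wcorner (rcons w b) =
  wcorner w + b%:R * (wwalk w + r (size w)) / 2 ^+ (size w).+1.
Proof.
rewrite /wcorner size_rcons cornerS nth_rcons_size; congr (_ + _ * (_ + _) / _).
  by apply: corner_ext => j; exact: nth_rcons_lt.
by apply: walk_ext => j; exact: nth_rcons_lt.
Qed.

Lemma keptP w :
  reflect (forall j, (j <= size w)%N -> 0 <= walk r (nth false w) j) (kept w).
Proof.
apply: (iffP allP) => H j; last by rewrite mem_iota => jw; apply: H; lia.
by move=> jw; apply: H; rewrite mem_iota; lia.
Qed.

Lemma kept_ge0 w : kept w -> 0 <= wwalk w.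
Proof. by move=> /keptP; exact. Qed.

Lemma kept_rcons w b : kept (rcons w b) = kept w && (0 <= wwalk (rcons w b)).
Proof.
have E j : (j <= size w)%N ->
    walk r (nth false (rcons w b)) j = walk r (nth false w) j.
  by move=> jw; apply: walk_ext => k kj; apply: nth_rcons_lt; exact: leq_trans jw.
apply/idP/andP => [H|[/keptP H1 H2]].
  split; last exact: kept_ge0.
  apply/keptP => j jw; rewrite -E //.
  by move/keptP: H; apply; rewrite size_rcons ltnW.
apply/keptP => j; rewrite size_rcons leq_eqVlt ltnS => /predU1P[->|jw].
  by rewrite -(size_rcons w b).
by rewrite E // H1.
Qed.

Lemma wwalk_mkseq e n : wwalk (mkseq e n) = walk r e n.
Proof. by rewrite /wwalk size_mkseq; apply: walk_ext => j jn; rewrite nth_mkseq. Qed.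

Lemma wcorner_mkseq e n : wcorner (mkseq e n) = corner r e n.
Proof.
by rewrite /wcorner size_mkseq; apply: corner_ext => j jn; rewrite nth_mkseq.
Qed.

Lemma kept_mkseqP e n :
  reflect (forall j, (j <= n)%N -> 0 <= walk r e j) (kept (mkseq e n)).
Proof.
have E j : (j <= n)%N -> walk r (nth false (mkseq e n)) j = walk r e j.
  by move=> jn; apply: walk_ext => k kj; rewrite nth_mkseq //; exact: leq_trans jn.
apply: (iffP (keptP _)); rewrite size_mkseq => H j jn; first by rewrite -E // H.
by rewrite E // H.
Qed.

(** The sum of [g d] over the words of length [n] whose walk is nonnegative and
ends at [d]. *)
Definition kept_sum n (g : R -> R) : R := \sum_(w <- words n | kept w) g (wwalk w).

(** The walk has one step up and one step down from each position. The step down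
from [0] leaves the nonnegative walks; it may be included in the sum because
[g] vanishes at [- 1]. *)
Lemma kept_sum_step n (g : R -> R) : g (- 1) = 0 ->
  kept_sum n.+1 g = kept_sum n (fun d => g (d + 1) + g (d - 1)).
Proof.
move=> g1; rewrite /kept_sum !(big_mkcond kept) big_words; apply: eq_bigr => w _.
rewrite !kept_rcons; case: (boolP (kept w)) => [kw|_] /=; last exact: addr0.
have d0 := kept_ge0 kw.
have s1 : 0 <= wwalk w + 1 by rewrite addr_ge0.
have s2 : (if 0 <= wwalk w - 1 then g (wwalk w - 1) else 0) = g (wwalk w - 1).
  case: ifPn => // H; case: (walk_case hr (nth false w) (size w)).
  - by rewrite -/(wwalk w) => ->; rewrite sub0r g1.
  - by rewrite -/(wwalk w) => ?; exfalso; move/negP: H; apply; lra.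
  - by rewrite -/(wwalk w) => ?; exfalso; lra.
rewrite !wwalk_rcons; case: (hr (size w)) => ->; rewrite /= expr0 expr1.
  by rewrite mulr1 mulrNN mul1r s2 s1 addrC.
by rewrite mulr1 mul1r s2 s1.
Qed.

Lemma kept_sumD n g h :
  kept_sum n (fun d => g d + h d) = kept_sum n g + kept_sum n h.
Proof. by rewrite /kept_sum big_split. Qed.

Lemma kept_sumZ n c g : kept_sum n (fun d => c * g d) = c * kept_sum n g.
Proof. by rewrite /kept_sum mulr_sumr. Qed.

Lemma kept_sum0 g : kept_sum 0 g = g 0.
Proof.
by rewrite /kept_sum /= big_mkcond big_seq1 /wwalk /= walk0 /kept /= walk0 lexx.
Qed.

(** [d + 1] is harmonic and vanishes at [- 1]. *)
Lemma kept_mean n : kept_sum n (fun d => d + 1) = 2 ^+ n.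
Proof.
elim: n => [|n IH]; first by rewrite kept_sum0 add0r.
rewrite kept_sum_step ?addNr // exprS -IH -kept_sumZ.
by apply: eq_bigr => w _; ring.
Qed.

(** The probability that a simple random walk stays nonnegative for [n] steps. *)
Definition survival n : R := kept_sum n (fun=> 1) / 2 ^+ n.

Lemma survival_ge0 n : 0 <= survival n.
Proof. by rewrite mulr_ge0 ?half_ge0 // sumr_ge0. Qed.

Lemma survivalS n : survival n.+1 <= survival n.
Proof.
rewrite /survival halfS mulrA ler_pM2r ?half_gt0 // ler_pdivrMr //.
rewrite /kept_sum !(big_mkcond kept) big_words mulr_suml ler_sum // => w _.
by rewrite !kept_rcons; case: (kept w) => /=; do 2?case: ifP => _; lra.
Qed.

(** The mean of [(d + 1) ^ 2] grows by [survival n] at each step, and [survival] is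
nonincreasing. *)
Lemma kept_second n :
  1 + n%:R * survival n <= kept_sum n (fun d => (d + 1) ^+ 2) / 2 ^+ n.
Proof.
elim: n => [|n IH]; first by rewrite kept_sum0 add0r mul0r addr0 expr1n expr0 divr1.
have -> : kept_sum n.+1 (fun d => (d + 1) ^+ 2) / 2 ^+ n.+1 =
    kept_sum n (fun d => (d + 1) ^+ 2) / 2 ^+ n + survival n.
  rewrite kept_sum_step ?addNr ?expr0n // /survival halfS -mulrDl -kept_sumD.
  rewrite mulrA; congr (_ / _); rewrite mulrC -kept_sumZ; apply: eq_bigr => w _.
  by field.
have := survivalS n; have := survival_ge0 n => s0 s1.
have : n%:R * survival n.+1 <= n%:R * survival n by rewrite ler_wpM2l.
by rewrite -natr1; lra.
Qed.

Lemma kept_third n : kept_sum n (fun d => (d + 1) ^+ 3) / 2 ^+ n = 1 + 3 * n%:R.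
Proof.
elim: n => [|n IH]; first by rewrite kept_sum0 add0r mulr0 addr0 expr1n expr0 divr1.
rewrite kept_sum_step ?addNr ?expr0n // -[n.+1%:R]natr1 mulrDr addrA -IH mulr1.
have : 3 * (kept_sum n (fun d => d + 1) / 2 ^+ n) = 3.
  by rewrite kept_mean mulfV ?expf_neq0 // mulr1.
move=> <-; rewrite halfS mulrA -mulrDl -kept_sumZ -kept_sumD mulrA; congr (_ / _).
by rewrite mulrC -kept_sumZ; apply: eq_bigr => w _; field.
Qed.

Lemma survival_sq K : (0 < K)%N -> survival (K ^ 2)%N <= 5 / 2 / K%:R.
Proof.
move=> K0; set n := (K ^ 2)%N; have k0 : 1 <= K%:R :> R by rewrite ler1n.
(* [2 K W^2 <= W^3 + K^2 W] for [W = d + 1], since [0 <= W (W - K)^2]. *)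
have A : 2 * K%:R * (kept_sum n (fun d => (d + 1) ^+ 2) / 2 ^+ n) <=
    kept_sum n (fun d => (d + 1) ^+ 3) / 2 ^+ n +
    K%:R ^+ 2 * (kept_sum n (fun d => d + 1) / 2 ^+ n).
  rewrite !mulrA -mulrDl ler_pM2r ?half_gt0 // -!kept_sumZ -kept_sumD.
  apply: ler_sum => w kw; have d0 := kept_ge0 kw.
  have : 0 <= (wwalk w + 1) * (wwalk w + 1 - K%:R) ^+ 2.
    by rewrite mulr_ge0 ?sqr_ge0 // addr_ge0.
  by set d := wwalk w; set k := K%:R; lra.
move: A; rewrite kept_third kept_mean mulfV ?expf_neq0 // mulr1.
have := kept_second n; rewrite {2 5}/n natrX; move: (survival n) => s B A.
have {B} B : 2 * K%:R * (1 + K%:R ^+ 2 * s) <= 1 + 3 * K%:R ^+ 2 + K%:R ^+ 2.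
  by apply: le_trans A; rewrite ler_pM2l // mulr_gt0 //; lra.
rewrite ler_pdivlMr; last lra.
nra.
Qed.

Lemma survival_cvg0 : survival @ \oo --> (0 : R).
Proof.
apply/cvgr0Pnorm_le => e e0.
pose K := (Num.truncn (5 / 2 / e)).+1.
have Ke : 5 / 2 / K%:R <= e.
  rewrite ler_pdivrMr ?ltr0n // [e * _]mulrC -ler_pdivrMr //; apply: ltW.
  exact: truncnS_gt.
exists (K ^ 2)%N => // n /= Kn; rewrite ger0_norm ?survival_ge0 //.
apply: le_trans Ke; apply: le_trans (survival_sq (ltn0Sn _)).
move: Kn => /subnK <-; elim: (n - _)%N => // k IH.
by rewrite addSn (le_trans (survivalS _)).
Qed.

End Kept.

(** * The values of the nonnegative extensions of a word *)

(** Koenig's lemma for binary words: if a property of words can always be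
preserved by adding one digit, it holds along an infinite word. *)
Lemma konig (P : seq bool -> Prop) (w : seq bool) :
  (forall v, P v -> P (rcons v false) \/ P (rcons v true)) -> P w ->
  exists2 e : nat -> bool, mkseq e (size w) = w &
    forall n, (size w <= n)%N -> P (mkseq e n).
Proof.
move=> PS Pw.
pose f v := rcons v `[< P (rcons v true) >].
pose ws k := iter k f w.
have wsS k : ws k.+1 = f (ws k) by [].
have sws k : size (ws k) = (k + size w)%N.
  by elim: k => // k IH; rewrite wsS size_rcons IH.
have Pws k : P (ws k).
  elim: k => // k IH; rewrite wsS /f; case: asboolP => // nP.
  by case: (PS _ IH).
have ext k j i : (j < size (ws k))%N ->
    nth false (ws (i + k)%N) j = nth false (ws k) j.
  move=> jk; elim: i => // i IH; rewrite addSn wsS nth_rcons IH.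
  by rewrite sws; move: jk; rewrite sws => jk; rewrite ifT //; lia.
pose e j := nth false (ws j.+1) j.
have He k : mkseq e (size (ws k)) = ws k.
  apply: (@eq_from_nth _ false); first by rewrite size_mkseq.
  move=> j; rewrite size_mkseq => jk; rewrite nth_mkseq // /e.
  have [kj|jk'] := leqP k j.+1.
    by rewrite -(subnK kj) ext.
  by rewrite -(subnK (ltnW jk')) ext // sws; lia.
exists e; first exact: (He 0%N).
by move=> n /subnK <-; rewrite -sws He.
Qed.

Section Branch.
Variables (R : realType) (r : nat -> R).
Hypothesis hr : sign_sequence r.
Implicit Types (e : nat -> bool) (x y : R) (n : nat) (w v : seq bool) (b : bool).

(** The digits that mark the negative signs of [r]. *)
Definition neg_sign n : bool := r n == -1.

(** The remainder of order [n] of the point with digits [neg_sign]. It is the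
right amount by which the corner of a nonnegative walk has to be lowered for
[box_rcons] to hold: from [d = 0] with [r n = -1], the only nonnegative
continuation moves the corner down by [2 ^- n.+1]. *)
Definition wtail n : R := bval neg_sign - bsum neg_sign n.

Lemma wtail_ge0 n : 0 <= wtail n.
Proof. by rewrite subr_ge0; apply: bsum_le_lim; exact: bsum_cvg. Qed.

Lemma wtail_le n : wtail n <= (2 ^+ n)^-1.
Proof. by rewrite lerBlDl; apply: bsum_lim_le; exact: bsum_cvg. Qed.

Lemma wtail_cvg0 : wtail @ \oo --> (0 : R).
Proof.
rewrite -(subrr (bval neg_sign)); apply: cvgB; first exact: cvg_cst.
exact: bsum_cvg.
Qed.

(** An interval of length [(d + 1) / 2 ^ n] that contains all the values of the
extensions of [w] with nonnegative walk. *)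
Definition box w : set R := [set y | kept r w /\
  wcorner r w - wtail (size w) <= y <=
  wcorner r w - wtail (size w) + (wwalk r w + 1) / 2 ^+ size w].

(** The union of the boxes of the extensions of [w] by [m] digits. *)
Definition box_at w m : set R :=
  \bigcup_(v in [set v | size v = (size w + m)%N /\ take (size w) v = w]) box v.

(** The set of the values of the extensions of [w] with nonnegative walk
(see [branch_fiber]); this form shows that it is measurable. *)
Definition branch w : set R := \bigcap_m box_at w m.

(** Boxes are nested along nonnegative walks. *)
Lemma box_rcons w b : box (rcons w b) `<=` box w.
Proof.
move=> y [kb]; have := kept_ge0 kb; move: kb; rewrite kept_rcons => /andP[kw _].
have := kept_ge0 kw; rewrite wcorner_rcons wwalk_rcons size_rcons /wtail bsumS.
rewrite halfS /neg_sign => d0 d1 /andP[y1 y2]; split=> //.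
move: y1 y2; rewrite /wtail.
have h0 := half_ge0 R (size w); have := mulr_ge0 d0 h0; have := mulr_ge0 d1 h0.
move: ((2 ^+ size w)^-1) (wwalk r w) (wcorner r w) (bval _) (bsum _ _) h0 d0 d1.
move=> h d a B C h0 d0 d1.
have e1 : (1 == -1 :> R) = false by apply/negbTE/eqP; lra.
case: b d1; case: (hr (size w)) => ->;
  rewrite ?e1 ?eqxx /= ?expr0 ?expr1 => d1 p q y1 y2; apply/andP; split; lra.
Qed.

Lemma take_rcons_le w v b : (size w <= size v)%N ->
  take (size w) (rcons v b) = take (size w) v.
Proof. by move=> wv; rewrite -cats1 takel_cat. Qed.

Lemma box_atS w m : box_at w m.+1 `<=` box_at w m.
Proof.
move=> y [v [sv tv] yv]; case/lastP: v sv tv yv => [|v b]; first by rewrite addnS.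
rewrite size_rcons addnS => -[sv] tv /box_rcons yv; exists v => //; split=> //.
by rewrite -[RHS]tv take_rcons_le // sv leq_addr.
Qed.

Lemma box_at_le w m k : (m <= k)%N -> box_at w k `<=` box_at w m.
Proof.
by move=> /subnK <-; elim: (k - m)%N => // i IH y; rewrite addSn => /box_atS /IH.
Qed.

(** If the boxes of both children fail to contain [y] at some depth, so do the
boxes of [w] at the next depth, because the unions of boxes decrease. *)
Lemma branch_split w y : branch w y ->
  branch (rcons w false) y \/ branch (rcons w true) y.
Proof.
move=> wy; apply: contrapT => /not_orP[n0 n1].
have [m0 H0] : exists m, ~ box_at (rcons w false) m y.
  by apply/existsNP => H; apply: n0 => m _.
have [m1 H1] : exists m, ~ box_at (rcons w true) m y.
  by apply/existsNP => H; apply: n1 => m _.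
have [v [sv tv] yv] := wy (maxn m0 m1).+1 I.
have wv : (size w < size v)%N by rewrite sv addnS ltnS leq_addr.
have : box_at (rcons w (nth false v (size w))) (maxn m0 m1) y.
  exists v => //=; rewrite size_rcons sv addnS; split=> //.
  by rewrite (take_nth false wv) tv.
case: (nth _ _ _) => H.
  by apply: H1; apply: box_at_le H; rewrite leq_maxr.
by apply: H0; apply: box_at_le H; rewrite leq_maxl.
Qed.

Lemma branch_box w : branch w `<=` box w.
Proof.
move=> y /(_ 0%N I)[v [sv tv]]; move: tv.
by rewrite -[X in take X]addn0 -sv take_size => ->.
Qed.

Lemma branch_fiber w y :
  branch w y <-> exists2 e, nonneg_fiber r y e & mkseq e (size w) = w.
Proof.
split=> [wy|[e [e0 ey] ew]].
  have [e ew He] := konig (fun v => @branch_split v y) wy.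
  have Hb n : (size w <= n)%N -> box (mkseq e n) y by move=> /He /branch_box.
  exists e => //; split=> [n|].
    have [/kept_mkseqP H _] := Hb (maxn n (size w)) (leq_maxr _ _).
    exact: H (leq_maxl _ _).
  have c1 : (fun n => corner r e n - wtail n) @ \oo --> takagi r (bval e).
    have := cvgB (corner_cvg hr (@bsum_cvg R e)) wtail_cvg0.
    by rewrite subr0; apply.
  apply/eqP; rewrite eq_le; apply/andP; split.
    apply: (cvgr_to_le c1); exists (size w) => // n /= /Hb[_ /andP[+ _]].
    by rewrite wcorner_mkseq size_mkseq.
  have c2 : (fun n => corner r e n - wtail n + walk r e n / 2 ^+ n +
      (2 ^+ n)^-1) @ \oo --> takagi r (bval e) + 0 + 0.
    by apply: cvgD (@half_cvg0 R); apply: cvgD (walk_half_cvg0 hr e); exact: c1.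
  rewrite !addr0 in c2.
  apply: (cvgr_to_ge c2); exists (size w) => // n /= /Hb[_ /andP[_]].
  by rewrite wcorner_mkseq wwalk_mkseq size_mkseq mulrDl mul1r addrA.
have c := corner_cvg hr (@bsum_cvg R e).
(* The later corners all lie in the box of [mkseq e n], which is closed. *)
have B n : box (mkseq e n) y.
  have kk k : kept r (mkseq e k) by apply/kept_mkseqP => j _.
  have N k : box (mkseq e n) (corner r e (k + n)).
    have : box (mkseq e (k + n)) (corner r e (k + n)).
      split=> //; rewrite wcorner_mkseq wwalk_mkseq size_mkseq.
      have := mulr_ge0 (e0 (k + n)%N) (half_ge0 R (k + n)).
      have := wtail_ge0 (k + n); have := wtail_le (k + n) => *.
      by apply/andP; split; lra.
    elim: k (corner r e (k + n)) => // k IH z.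
    by rewrite addSn mkseqS => /box_rcons /IH.
  split=> //; rewrite -ey; apply/andP; split.
    apply: (cvgr_to_ge c); exists n => // m /= /subnK <-.
    by have [_ /andP[]] := N (m - n)%N.
  apply: (cvgr_to_le c); exists n => // m /= /subnK <-.
  by have [_ /andP[]] := N (m - n)%N.
move=> m _; exists (mkseq e (size w + m)) => //=; rewrite size_mkseq; split=> //.
rewrite -[RHS]ew /mkseq -map_take take_iota; congr (map _ (iota _ _)).
by apply/minn_idPl; rewrite leq_addr.
Qed.

(** The range of the partial sum of order [n] on the dyadic interval of the word
[w] of length [n]; it is empty unless the walk of [w] is nonnegative. *)
Definition segment w : set R := [set y | kept r w /\
  wcorner r w <= y <= wcorner r w + wwalk r w / 2 ^+ size w].

Lemma segment_split w y : segment w y -> exists b, segment (rcons w b) y.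
Proof.
move=> [kw]; have := kept_ge0 kw => d0 wy.
suff [b [b0 by_]] : exists b, 0 <= wwalk r (rcons w b) /\
    wcorner r (rcons w b) <= y <=
    wcorner r (rcons w b) + wwalk r (rcons w b) / 2 ^+ (size w).+1.
  by exists b; split; [rewrite kept_rcons kw|rewrite size_rcons].
have [D0|D1|?] := walk_case hr (nth false w) (size w); last first.
- by exfalso; move: d0; rewrite /wwalk; lra.
- rewrite -/(wwalk r w) in D1.
  (* The next corner splits the segment into the segments of the children. *)
  have [yc|cy] := leP y
    (wcorner r w + (wwalk r w + r (size w)) * (2 ^+ (size w).+1)^-1).
    exists false; rewrite wcorner_rcons wwalk_rcons; move: wy yc => /andP[y1 y2] yc.
    split; first by case: (hr (size w)) => ->; rewrite /= ?expr0; lra.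
    by apply/andP; split; move: yc; rewrite /= ?expr0; lra.
  exists true; rewrite wcorner_rcons wwalk_rcons; move: wy cy => /andP[y1 y2] cy.
  split; first by case: (hr (size w)) => ->; rewrite /= ?expr1; lra.
  by apply/andP; split; move: cy y2; rewrite /= ?expr1 halfS; lra.
(* The segment is a point, and only one child has a nonnegative walk. *)
rewrite -/(wwalk r w) in D0.
exists (neg_sign (size w)); rewrite wcorner_rcons wwalk_rcons /neg_sign halfS.
move: wy; rewrite D0 mul0r addr0 => /andP[y1 y2].
have h0 := half_ge0 R (size w).
have e1 : (1 == -1 :> R) = false by apply/negbTE/eqP; lra.
by case: (hr (size w)) => ->; rewrite ?e1 ?eqxx /= ?expr0 ?expr1; split;
  [lra|apply/andP; split; lra|lra|apply/andP; split; lra].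
Qed.

Lemma segment_branch w : segment w `<=` branch w.
Proof.
move=> y wy m _.
suff [v [sv tv [kv /andP[y1 y2]]]] : exists v,
    [/\ size v = (size w + m)%N, take (size w) v = w & segment v y].
  exists v => //; split=> //; have := wtail_ge0 (size v); have := wtail_le (size v).
  by move=> *; apply/andP; split; lra.
elim: m => [|m [v [sv tv yv]]]; first by exists w; rewrite addn0 take_size.
have [b yb] := segment_split yv; exists (rcons v b); split=> //.
  by rewrite size_rcons sv addnS.
by rewrite take_rcons_le // sv leq_addr.
Qed.

End Branch.

(** * The number of local level sets *)

Section CountPrefixes.
Variable S : set (nat -> bool).

(** The number of words of length [n] that are a prefix of an element of [S]. *)
Definition prefix_count n : nat :=
  count (fun w => `[< exists2 e, S e & mkseq e n = w >]) (words n).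

Lemma prefix_count_le n : finite_set S -> (prefix_count n <= #|` fset_set S|)%N.
Proof.
move=> fS; rewrite /prefix_count -size_filter; set L := [seq w <- _ | _].
pose g w := xget (fun=> false) [set e | S e /\ mkseq e n = w].
have gP w : w \in L -> S (g w) /\ mkseq (g w) n = w.
  rewrite mem_filter => /andP[/asboolP[e Se ew] _].
  by apply: (@xgetPex _ _ [set e | S e /\ mkseq e n = w]); exists e.
rewrite -(size_map g); apply: uniq_leq_size.
  rewrite map_inj_in_uniq ?filter_uniq ?uniq_words //.
  by move=> u v /gP[_ gu] /gP[_ gv] guv; rewrite -gu guv gv.
by move=> _ /mapP[w /gP[Sw _] ->]; rewrite in_fset_set //; first exact: mem_set.
Qed.

(** Long prefixes distinguish the elements of a finite set. *)
Lemma separating_prefix (s : seq (nat -> bool)) :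
  exists n0, forall n, (n0 <= n)%N -> {in s &, injective (fun e => mkseq e n)}.
Proof.
pose d (e e' : nat -> bool) := xget 0%N [set j | e j != e' j].
exists (\max_(e <- s) \max_(e' <- s) (d e e').+1) => n sn e e' es e's ee'.
apply: contrapT => ne; have dP : e (d e e') != e' (d e e').
  apply: (@xgetPex _ 0%N [set j | e j != e' j]).
  apply: contrapT => H; apply: ne; apply/funext => j; apply/eqP/negPn/negP => jj.
  by apply: H; exists j.
have dn : (d e e' < n)%N.
  apply: leq_trans sn; apply: leq_trans (leq_bigmax_seq e es isT).
  exact: leq_trans (leq_bigmax_seq (F := fun e' => (d e e').+1) e' e's isT).
by move/eqP: dP; apply; rewrite -(nth_mkseq false e dn) ee' nth_mkseq.
Qed.

Lemma prefix_count_ge (s : seq (nat -> bool)) : uniq s -> {in s, forall e, S e} ->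
  \forall n \near \oo, (size s <= prefix_count n)%N.
Proof.
move=> us sS; have [n0 H] := separating_prefix s; exists n0 => // n /= n0n.
rewrite /prefix_count -size_filter -(size_map (fun e => mkseq e n)).
apply: uniq_leq_size; first by rewrite map_inj_in_uniq //; exact: H.
move=> _ /mapP[e es ->]; rewrite mem_filter mem_words size_mkseq eqxx andbT.
by apply/asboolP; exists e => //; exact: sS.
Qed.

(** This also covers infinite [S], for which the limit is [+oo]. *)
Lemma prefix_count_cvg (R : realType) :
  (fun n => ((prefix_count n)%:R : R)%:E) @ \oo --> (counting S : \bar R).
Proof.
rewrite /counting; case: asboolP => [fS|iS].
  apply: cvg_near_cst.
  have [|e|n0 _ H] := @prefix_count_ge (fset_set S); first exact: fset_uniq.
    by rewrite in_fset_set // => /set_mem.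
  exists n0 => // n /H le_n; congr (_%:R%:E); apply/eqP.
  by rewrite eqn_leq prefix_count_le.
apply/cvgeyPge => A; have [B BS AB] := infinite_set_fset (Num.truncn A).+1 iS.
have [|e eB|n0 _ H] := @prefix_count_ge (enum_fset B); first exact: fset_uniq.
  exact: BS.
exists n0 => // n /H le_n; rewrite lee_fin; apply: le_trans (ltW (truncnS_gt A)) _.
by rewrite ler_nat; exact: leq_trans le_n.
Qed.

End CountPrefixes.

Lemma counting_card_eq (R : realType) (T U : choiceType) (A : set T) (B : set U) :
  (A #= B)%card -> counting A = counting B :> \bar R.
Proof.
move=> AB; rewrite /counting (eq_finite_set AB); case: asboolP => // fB.
congr (_%:R%:E); apply/fcard_eq => //; by rewrite (eq_finite_set AB).
Qed.

Section Integral.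
Variables (R : realType) (r : nat -> R).
Hypothesis hr : sign_sequence r.
Local Notation mu := (@lebesgue_measure R).
Local Notation fiber := (nonneg_fiber r).

Lemma measurable_and_itv (b : bool) (a c : R) :
  measurable [set y : R | b /\ a <= y <= c].
Proof.
case: b.
  have -> : [set y : R | true /\ a <= y <= c] = `[a, c]%classic.
    by apply/seteqP; split=> y; rewrite /= in_itv /=; [case|split].
  exact: measurable_itv.
by have -> : [set y : R | false /\ a <= y <= c] = set0;
  [apply/seteqP; split=> y [] | exact: measurable0].
Qed.

Lemma measure_and_itv (b : bool) (a l : R) : 0 <= l ->
  mu [set y : R | b /\ a <= y <= a + l] = (if b then l else 0)%:E.
Proof.
move=> l0; case: b.
  have -> : [set y : R | true /\ a <= y <= a + l] = `[a, a + l]%classic.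
    by apply/seteqP; split=> y; rewrite /= in_itv /=; [case|split].
  rewrite lebesgue_measure_itv /= lte_fin ltrDl -EFinD.
  by case: (ltrgtP 0 l) l0 => // [_|<-] _ //; rewrite addrAC subrr add0r.
by have -> : [set y : R | false /\ a <= y <= a + l] = set0;
  [apply/seteqP; split=> y [] | exact: measure0].
Qed.

Lemma branch_measurable w : measurable (branch r w).
Proof.
apply: bigcapT_measurable => m.
rewrite /box_at bigcup_mkcond.
apply: countable_bigcupT_measurable; first exact: countableP.
move=> v; case: ifPn => _; last exact: measurable0.
exact: measurable_and_itv.
Qed.

(** The branch of a word lies in its box, which is empty when the walk of the word
takes a negative value. *)
Lemma mu_branch_le w : (mu (branch r w) <=
  (if kept r w then (wwalk r w + 1) / 2 ^+ size w else 0)%:E)%E.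
Proof.
have [kw|nk] := boolP (kept r w); last first.
  rewrite (_ : branch r w = set0) ?measure0 //; apply/seteqP; split=> y // /branch_box.
  by move=> [kw _]; rewrite kw in nk.
have l0 : 0 <= (wwalk r w + 1) / 2 ^+ size w.
  by rewrite mulr_ge0 ?half_ge0 // addr_ge0 // kept_ge0.
have <- := measure_and_itv true (wcorner r w - wtail r (size w)) l0.
apply: le_measure.
- by apply: mem_set; exact: branch_measurable.
- by apply: mem_set; exact: (measurable_and_itv true).
- by move=> y /branch_box[_ yw]; split.
Qed.

Lemma mu_branch_ge w : ((if kept r w then wwalk r w / 2 ^+ size w else 0)%:E <=
  mu (branch r w))%E.
Proof.
have [kw|nk] := boolP (kept r w); last exact: measure_ge0.
have l0 : 0 <= wwalk r w / 2 ^+ size w by rewrite mulr_ge0 ?half_ge0 // kept_ge0.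
have <- := measure_and_itv true (wcorner r w) l0.
apply: le_measure.
- by apply: mem_set; exact: (measurable_and_itv true).
- by apply: mem_set; exact: branch_measurable.
- by move=> y [_ yw]; apply: (segment_branch hr).
Qed.

(** The number of words of length [n] with an extension of nonnegative walk and
value [y]. *)
Definition branch_count n (y : R) : \bar R :=
  (\sum_(w <- words n) (\1_(branch r w) y)%:E)%E.

Lemma branch_countE n y : branch_count n y = ((prefix_count (fiber y) n)%:R)%:E.
Proof.
rewrite /branch_count sumEFin /prefix_count -sum1_count natr_sum [in RHS]big_mkcond /=.
congr (_%:E); rewrite !big_seq; apply: eq_bigr => w; rewrite mem_words => /eqP <-.
rewrite indicE; case: asboolP => H.
  by rewrite mem_set //; apply/branch_fiber.
by rewrite memNset // => /(branch_fiber hr).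
Qed.

Lemma branch_count_homo y :
  {homo branch_count ^~ y : n m / (n <= m)%N >-> (n <= m)%E}.
Proof.
apply/nondecreasing_seqP => n; rewrite /branch_count !sumEFin lee_fin big_words.
apply: ler_sum => w _; rewrite !indicE -natrD ler_nat.
have [/set_mem/(branch_split hr)[]|] := boolP (y \in branch r w) => //.
  by move=> /mem_set ->.
by move=> /mem_set ->; rewrite addnC.
Qed.

Lemma branch_count_measurable n : measurable_fun [set: R] (branch_count n).
Proof.
apply: emeasurable_sum => w; apply/measurable_EFinP.
by apply: measurable_indic; exact: branch_measurable.
Qed.

Lemma branch_count_cvg y : branch_count ^~ y @ \oo --> (counting (fiber y) : \bar R).
Proof. by under eq_fun do rewrite branch_countE; exact: prefix_count_cvg. Qed.

Lemma integral_branch_count n :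
  (\int[mu]_(y in [set: R]) branch_count n y = \sum_(w <- words n) mu (branch r w))%E.
Proof.
rewrite ge0_integral_sum //; last first.
  move=> w; apply/measurable_EFinP.
  by apply: measurable_indic; exact: branch_measurable.
by apply: eq_bigr => w _; rewrite integral_indic ?setIT //; exact: branch_measurable.
Qed.

Lemma integral_branch_count_le n :
  (\int[mu]_(y in [set: R]) branch_count n y <= 1)%E.
Proof.
rewrite integral_branch_count.
apply: le_trans (lee_sum _ (fun w _ => mu_branch_le w)) _.
rewrite sumEFin lee_fin big_seq.
rewrite (eq_bigr (fun w => if kept r w then (wwalk r w + 1) / 2 ^+ n else 0)); last first.
  by move=> w; rewrite mem_words => /eqP ->.
by rewrite -big_seq -big_mkcond -mulr_suml [X in X / _](kept_mean hr) mulfV ?expf_neq0.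
Qed.

Lemma integral_branch_count_ge n :
  ((1 - survival r n)%:E <= \int[mu]_(y in [set: R]) branch_count n y)%E.
Proof.
rewrite integral_branch_count.
apply: le_trans _ (lee_sum _ (fun w _ => mu_branch_ge w)).
rewrite sumEFin lee_fin [leRHS]big_seq.
rewrite (eq_bigr (fun w => if kept r w then wwalk r w / 2 ^+ n else 0)); last first.
  by move=> w; rewrite mem_words => /eqP ->.
rewrite -big_seq -big_mkcond -mulr_suml /survival.
rewrite -[X in X - _ <= _](@mulfV _ (2 ^+ n : R)) ?expf_neq0 //.
by rewrite -mulrBl -(kept_mean hr) kept_sumD addrK.
Qed.

Lemma integral_counting_fiber :
  (\int[mu]_(y in [set: R]) counting (fiber y) = 1)%E.
Proof.
have H1 : (\int[mu]_(y in [set: R]) branch_count n y)%E @[n --> \oo] -->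
    (\int[mu]_(y in [set: R]) counting (fiber y))%E.
  rewrite (_ : (fun y => counting (fiber y)) =
               (fun y => limn (branch_count ^~ y))); last first.
    by apply/funext => y; apply/esym/cvg_lim => //; exact: branch_count_cvg.
  apply: cvg_monotone_convergence => //.
  - exact: branch_count_measurable.
  - by move=> n y _; rewrite branch_countE lee_fin.
  - by move=> y _; exact: branch_count_homo.
have H2 : (\int[mu]_(y in [set: R]) branch_count n y)%E @[n --> \oo] --> (1%E : \bar R).
  apply: (@squeeze_cvge _ _ _ _ (fun n => (1 - survival r n)%:E) _ (cst 1%E)).
  - by apply: nearW => n; rewrite integral_branch_count_ge integral_branch_count_le.
  - apply: cvg_EFin; first exact: nearW.
    rewrite -[X in _ --> X]subr0; apply: cvgB; [exact: cvg_cst|exact: survival_cvg0].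
  - exact: cvg_cst.
exact: (cvg_unique _ H1 H2).
Qed.

Lemma counting_fiber_measurable :
  measurable_fun [set: R] (fun y => counting (fiber y) : \bar R).
Proof.
apply: (emeasurable_fun_cvg branch_count); first exact: branch_count_measurable.
by move=> y _; exact: branch_count_cvg.
Qed.

Lemma Nloc_fiber y : ~ exceptional r y -> Nloc r y = counting (fiber y).
Proof.
move=> ny; rewrite /Nloc in_local_level_sets //; apply: counting_card_eq.
exact: inj_card_eq (local_level_set_inj hr ny).
Qed.

Lemma exceptional_measurable : measurable (exceptional r).
Proof.
apply: countable_measurable; first exact: measurable_set1.
exact: exceptional_countable.
Qed.

Lemma Nloc_measurable : measurable_fun [set: R] (Nloc r).
Proof.
(* On the countable exceptional set, every function is measurable. *)
rewrite -(setUv (exceptional r)); apply/measurable_funU.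
- exact: exceptional_measurable.
- by apply: measurableC; exact: exceptional_measurable.
split.
  move=> _ Y _; apply: countable_measurable; first exact: measurable_set1.
  apply: sub_countable (exceptional_countable r); apply: subset_card_le.
  exact: subIsetl.
apply: (eq_measurable_fun (fun y => counting (fiber y))).
  by move=> y /set_mem ny; rewrite Nloc_fiber.
by apply: measurable_funTS; exact: counting_fiber_measurable.
Qed.

Lemma integral_Nloc : (\int[mu]_(y in [set: R]) Nloc r y = 1)%E.
Proof.
rewrite -integral_counting_fiber; apply: ae_eq_integral => //.
- exact: Nloc_measurable.
- exact: counting_fiber_measurable.
exists (exceptional r); split; first exact: exceptional_measurable.
  by apply: countable_lebesgue_measure0; exact: exceptional_countable.
by move=> y /= H; apply: contrapT => ny; apply: H => _; exact: Nloc_fiber.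
Qed.

End Integral.

Theorem theorem5p2 (R : realType) (r : nat -> R) (hr : sign_sequence r) :
  [/\ measurable_fun [set: R] (Nloc r),
      avg_Nloc r = ((height (takagi r))^-1)%:E,
      ((3 / 2)%:E <= avg_Nloc r)%E &
      (avg_Nloc r <= 2%:E)%E].
Proof.
have avgE : avg_Nloc r = ((height (takagi r))^-1)%:E.
  by rewrite /avg_Nloc integral_Nloc // mule1.
have /andP[h1 h2] := height_itv hr.
have h0 : 0 < height (takagi r) by apply: lt_le_trans h1; rewrite divr_gt0.
split=> //; first exact: Nloc_measurable.
  rewrite avgE lee_fin -[leLHS]invrK lef_pV2 ?posrE ?invr_gt0 ?divr_gt0 //.
  by rewrite invf_div.
rewrite avgE lee_fin -[leRHS]invrK lef_pV2 ?posrE ?invr_gt0 //.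
by rewrite -[_^-1]mul1r.
Qed.
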